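(* Let $G=(V(G),E(G))$ be a cubic graph (every vertex has degree three) with $|V(G)|=n$. Then $$\gamma_{2\text{-SRD}}(G)\geqslant \frac{2n}{3}.$$
   Context: All graphs are finite, simple and undirected; $N(v)$ denotes the set of neighbors of $v$ and $\Delta(G)$ the maximum degree. Let $k\geqslant 1$ be an integer with $|V(G)|\geqslant k$. An attack pattern is a set $P\subseteq V(G)$ with $|P|=k$. A function $f:V(G)\to\{0,1,\ldots,\min(\Delta(G),k)+1\}$ is a proper $k$-SRD ($k$-strong Roman domination) function if for each attack pattern $P$ every vertex $u\in P$ with $f(u)=0$ can be defended by a neighboring vertex, where each vertex $v$ with $f(v)\geqslant 2$ can defend at most $f(v)-1$ of its neighbors in $P$ labeled 0 (and vertices with label $\leqslant 1$ defend no other vertex). That is, for each $P$ there is a map $\delta_P:\{u\in P : f(u)=0\}\to V(G)$ (which may depend on $P$) such that $\delta_P(u)\in N(u)$ and $f(\delta_P(u))\geqslant 2$ for all $u$ in its domain, and $|\delta_P^{-1}(v)|\leqslant f(v)-1$ for every $v$ with $f(v)\geqslant 2$. The weight is $\omega(f)=\sum_{v\in V(G)}f(v)$, and the $k$-SRD number is $\gamma_{k\text{-SRD}}(G)=\min\{\omega(f) : f \text{ is a proper } k\text{-SRD function on } G\}$. Here $k=2$. *)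

(* Defs.v *)
From mathcomp Require Import all_boot all_order all_algebra.

Set Implicit Arguments.
Unset Strict Implicit.
Unset Printing Implicit Defensive.

(* MathComp; a finite simple graph is a symmetric irreflexive adjacency
   relation e on a finType T. *)

Section StrongRomanDomination.

Variables (T : finType) (e : rel T).

Definition nbhd (v : T) : {set T} := [set u | e v u].

Definition maxdeg : nat := \max_(v : T) #|nbhd v|.

Definition cubic : Prop := forall v : T, #|nbhd v| = 3.

Variable k : nat.

(* 'I_m.+2 is {0, ..., m + 1}, here with m = min(Delta(G), k). *)
Definition labeling : finType := {ffun T -> 'I_(minn maxdeg k).+2}.

Definition weight (f : labeling) : nat := \sum_(v : T) f v.

Definition attacked0 (f : labeling) (P : {set T}) : {set T} :=
  [set u in P | f u == 0 :> nat].

(* The partial map assigning a defender to each attacked vertex of label 0 is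
   represented by a total function d, constrained
   only on attacked0 f P. *)
Definition defense (f : labeling) (P : {set T}) (d : {ffun T -> T}) : bool :=
  [forall u in attacked0 f P, (d u \in nbhd u) && (2 <= f (d u))] &&
  [forall v, (2 <= f v) ==>
             (#|[set u in attacked0 f P | d u == v]| <= f v - 1)].

Definition proper_SRD (f : labeling) : bool :=
  [forall P : {set T}, (#|P| == k) ==> [exists d, defense f P d]].

Definition SRD_weight : pred nat :=
  fun w => [exists f : labeling, proper_SRD f && (weight f == w)].

Lemma ex_SRD_weight : exists w, SRD_weight w.
Proof.
pose f : labeling := [ffun=> Ordinal (isT : 1 < (minn maxdeg k).+2)].
exists (weight f); apply/existsP; exists f; rewrite eqxx andbT.
apply/forallP => P; apply/implyP => _.
apply/existsP; exists [ffun u => u]; apply/andP; split.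
  by apply/forall_inP => u; rewrite inE [f u]ffunE andbF.
by apply/forallP => v; rewrite ffunE.
Qed.

Definition gamma_SRD : nat := ex_minn ex_SRD_weight.

End StrongRomanDomination.

(* Main.v *)
Require Import Defs.
From mathcomp Require Import all_boot all_order all_algebra.
From mathcomp Require Import zify.

Set Implicit Arguments.
Unset Strict Implicit.
Unset Printing Implicit Defensive.

(** Discharging, with all charges multiplied by 3: v starts with 3 f(v), and
   each v with f(v) >= 2 sends every neighbor of label 0 one unit, or two units
   if v is its only possible defender. Every vertex ends with at least 2: a
   vertex of label 2 has at most one neighbor depending on it alone, since it
   could not defend two such neighbors attacked together, so it sends at most
   4; a vertex of label at least 3 sends at most 6. *)

Section Discharging.

Variables (T : finType) (e : rel T) (k : nat) (f : labeling e k).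

Definition defenders (u : T) : {set T} := [set v in nbhd e u | 2 <= f v].

Definition zero_nbhd (v : T) : {set T} := [set u in nbhd e v | f u == 0 :> nat].

(** The sole defender is not named here; it is [v] itself as soon as [f v >= 2], because [v] then
    defends [u]. *)
Definition private_nbhd (v : T) : {set T} :=
  [set u in zero_nbhd v | #|defenders u| == 1].

Definition charge (v u : T) : nat :=
  if (f u == 0 :> nat) && (v \in defenders u)
  then 1 + (#|defenders u| == 1) else 0.

Lemma defense_in_defenders (P : {set T}) (d : {ffun T -> T}) (u : T) :
  defense f P d -> u \in P -> f u = 0 :> nat -> d u \in defenders u.
Proof.
case/andP=> /forall_inP dP _ uP fu0.
by have := dP u; rewrite !inE uP fu0 eqxx => /(_ isT).
Qed.

(** Complete [u] by [k - 1] other vertices to an attack pattern; whatever vertex defends [u] there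
    is one of its [defenders]. *)
Lemma defenders_neq0 (u : T) :
  proper_SRD f -> 0 < k <= #|T| -> f u = 0 :> nat -> 0 < #|defenders u|.
Proof.
move=> /forallP fP /andP[k_gt0 k_le] fu0.
have cardC : k.-1 <= #|[set~ u]| by rewrite cardsC1; lia.
case/card_geqP: cardC => s [s_uniq s_size sP].
have us : u \notin s by apply/negP => /sP; rewrite !inE eqxx.
have /implyP := fP [set x in u :: s].
have /card_uniqP : uniq (u :: s) by rewrite /= us.
rewrite cardsE => -> /=; rewrite s_size prednK // eqxx => /(_ isT).
case/existsP=> d /defense_in_defenders dP.
by apply/card_gt0P; exists (d u); apply: dP => //; rewrite !inE eqxx.
Qed.

(** A single defender sends 2, and several send 1 each. *)
Lemma charge_received (u : T) :
  0 < #|defenders u| -> f u = 0 :> nat -> 2 <= \sum_v charge v u.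
Proof.
move=> D_gt0 fu0; rewrite /charge fu0 eqxx /= -big_mkcond /= sum_nat_const.
by case: eqP; lia.
Qed.

Hypothesis e_sym : symmetric e.

Lemma charge_sent (v : T) : 2 <= f v ->
  \sum_u charge v u = #|zero_nbhd v| + #|private_nbhd v|.
Proof.
move=> fv2; rewrite -!sum1_card [X in _ + X]big_mkcond [X in X + _]big_mkcond.
rewrite -big_split; apply: eq_bigr => u _ /=.
rewrite /charge !inE fv2 andbT e_sym andbC.
by case: (_ && _) => //=; case: eqP.
Qed.

Lemma charge_sent_weak (v : T) : f v < 2 -> \sum_u charge v u = 0.
Proof.
by move=> fv; apply: big1 => u _; rewrite /charge !inE leqNgt fv !andbF.
Qed.

Lemma private_defender (v u w : T) :
  2 <= f v -> u \in private_nbhd v -> w \in defenders u -> w = v.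
Proof.
move=> fv2; rewrite inE => /andP[uv /cards1P[x Dx]].
have : v \in defenders u by move: uv; rewrite !inE fv2 e_sym andbT => /andP[].
by rewrite Dx !inE => /eqP-> /eqP.
Qed.

End Discharging.

Lemma card_private_nbhd (T : finType) (e : rel T) (f : labeling e 2) (v : T) :
  symmetric e -> proper_SRD f -> f v = 2 :> nat -> #|private_nbhd f v| <= 1.
Proof.
move=> e_sym /forallP fP fv2; rewrite leqNgt; apply/negP.
case/card_gt1P=> x [y [xB yB xy]].
(* Two private neighbors form an attack pattern by themselves, as [k = 2]. *)
have /implyP := fP [set x; y]; rewrite cards2 xy => /(_ isT) /existsP[d dP].
have f0 u : u \in private_nbhd f v -> f u = 0 :> nat.
  by rewrite !inE => /andP[/andP[_ /eqP]].
have dv u : u \in private_nbhd f v -> u \in [set x; y] -> d u = v.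
  move=> uB uP; apply: (private_defender e_sym _ uB); first by rewrite fv2.
  exact: defense_in_defenders dP uP (f0 u uB).
(* Both attacked vertices fall to [v], whose capacity is [2 - 1 = 1]. *)
case/andP: dP => _ /forallP/(_ v); rewrite fv2 /=; apply/negP; rewrite -ltnNge.
apply/card_gt1P; exists x, y; split=> //.
  by rewrite inE (dv x) ?set21 // inE set21 f0 ?eqxx.
by rewrite inE (dv y) ?set22 // inE set22 f0 ?eqxx.
Qed.

Lemma weight_lower_bound (T : finType) (e : rel T) (f : labeling e 2) :
  symmetric e -> 2 <= #|T| -> cubic e -> proper_SRD f ->
  2 * #|T| <= 3 * weight f.
Proof.
move=> e_sym card_T e_cubic f_proper.
(* The charge sent stands on the left to avoid truncated subtraction. *)
have final_charge v :
    2 + \sum_u charge f v u <= 3 * f v + \sum_u charge f u v.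
  have zero_le3 : #|zero_nbhd f v| <= 3.
    by rewrite -(e_cubic v); apply/subset_leq_card/subsetP=> u /setIdP[].
  have private_le : #|private_nbhd f v| <= #|zero_nbhd f v|.
    by apply/subset_leq_card/subsetP=> u /setIdP[].
  have [fv2|fv2] := ltnP (f v) 2.
    rewrite charge_sent_weak //.
    (* Label 1 keeps its 3 units; label 0 lives on what it receives. *)
    have [fv0|] := eqVneq (f v : nat) 0; last by lia.
    have := charge_received (defenders_neq0 f_proper card_T fv0) fv0.
    by lia.
  rewrite charge_sent //.
  (* Label at least 3 keeps [9 - (3 + 3)] or more; label 2 keeps at least [6 - (3 + 1) = 2], with no
     slack. *)
  have [fv_eq2|] := eqVneq (f v : nat) 2; last by lia.
  by have := card_private_nbhd e_sym f_proper fv_eq2; lia.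
have : \sum_v (2 + \sum_u charge f v u)
       <= \sum_v (3 * f v + \sum_u charge f u v).
  by apply: leq_sum => v _; apply: final_charge.
(* Summed over all vertices, charge sent equals charge received, so the two double sums cancel. *)
rewrite [leqLHS]big_split [leqRHS]big_split /= [X in _ <= _ + X]exchange_big leq_add2r.
by rewrite sum_nat_const -big_distrr mulnC.
Qed.

Theorem theorem1 (T : finType) (e : rel T)
    (e_sym : symmetric e) (e_irr : irreflexive e)
    (card_T : 2 <= #|T|) (e_cubic : cubic e) :
  (2%:R * #|T|%:R / 3%:R <= (gamma_SRD e 2)%:R :> rat)%R.
Proof.
rewrite Num.Theory.ler_pdivrMr ?Num.Theory.ltr0n //.
rewrite -!GRing.natrM Num.Theory.ler_nat [leqRHS]mulnC.
rewrite /gamma_SRD; case: ex_minnP => w /existsP[f /andP[f_proper /eqP<-]] _.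
exact: weight_lower_bound.
Qed.
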